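(* For every combinatorial auction with nonempty winner set $W$, the BLO outcome $\pi^{BLO}$ and any MRC outcome $\pi^{MRC}$ satisfy $$\sum_{i\in N}\pi^{BLO}_i\ \ge\ \frac{4}{|W|+2+\frac{|W|\bmod 2}{|W|}}\ \sum_{i\in N}\pi^{MRC}_i .$$ The bound is tight: for every integer $k\ge1$ there is a combinatorial auction with $|W|=k$ and $\sum_i\pi^{MRC}_i>0$ for which equality holds.
   Context: A combinatorial auction (CA) has a finite set of bidders $N=\{1,\dots,n\}$, a finite set of items $M$, and for each bidder $i$ a valuation $v_i:2^M\to\mathbb{R}_{\ge 0}$ with $v_i(\emptyset)=0$ (bids are assumed equal to true valuations). For $S\subseteq N$ let $w(S)=\max\{\sum_{i\in S}v_i(a_i): a_i\subseteq M,\ a_i\cap a_j=\emptyset\ (i\ne j)\}$ (with $w(\emptyset)=0$). Fix an allocation $(a^*_i)_{i\in N}$ attaining $w(N)$; the winner set is $W=\{i: a^*_i\neq\emptyset\}$. The core is $U=\{\pi\in\mathbb{R}^N:\ \pi_i\ge 0\ \forall i\in N,\ \sum_{i\in N\setminus S}\pi_i\le w(N)-w(S)\ \forall S\subseteq N\}$. An MRC outcome is a $\pi\in U$ maximizing $\sum_{i\in N}\pi_i$ over $U$. For $x,y\in\mathbb{R}^n$, $x$ leximin-dominates $y$ if, writing $x_{(1)}\le\dots\le x_{(n)}$ and $y_{(1)}\le\dots\le y_{(n)}$ for the sorted entries, there is $0\le k\le n-1$ with $x_{(j)}=y_{(j)}$ for $j\le k$ and $x_{(k+1)}>y_{(k+1)}$.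 The BLO outcome $\pi^{BLO}$ is the (unique) $\pi\in U$ not leximin-dominated by any $\pi'\in U$. *)

(* Defs.v *)
From HB Require Import structures.
From mathcomp Require Import all_boot all_order all_algebra.
From mathcomp Require Import reals.
Set Implicit Arguments. Unset Strict Implicit. Unset Printing Implicit Defensive.
Import Order.TTheory GRing.Theory Num.Theory.
Local Open Scope ring_scope.

Section CA.
Variables (R : realType) (n : nat) (M : finType).
Variable v : 'I_n -> {set M} -> R.

Definition valuation_ok : Prop :=
  (forall i A, 0 <= v i A) /\ (forall i, v i set0 = 0).

Definition feasible (a : 'I_n -> {set M}) : bool :=
  [forall i, forall j, (i != j) ==> [disjoint a i & a j]].

(* w(S) = max over feasible allocations of sum_{i in S} v_i(a_i).
   The all-empty allocation is feasible with value 0, so folding max with 0 is exact. *)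
Definition w (S : {set 'I_n}) : R :=
  \big[Num.max/0]_(a : {ffun 'I_n -> {set M}} | feasible a) \sum_(i in S) v i (a i).

Definition optimal_alloc (a : 'I_n -> {set M}) : Prop :=
  feasible a /\ \sum_(i in [set: 'I_n]) v i (a i) = w [set: 'I_n].

Definition winners (a : 'I_n -> {set M}) : {set 'I_n} := [set i | a i != set0].

Definition in_core (pi : 'I_n -> R) : Prop :=
  (forall i, 0 <= pi i) /\
  (forall S : {set 'I_n}, \sum_(i in ~: S) pi i <= w [set: 'I_n] - w S).

Definition revenue (pi : 'I_n -> R) : R := \sum_(i < n) pi i.

Definition is_MRC (pi : 'I_n -> R) : Prop :=
  in_core pi /\ forall pi', in_core pi' -> revenue pi' <= revenue pi.

Definition sorted_entries (x : 'I_n -> R) : seq R :=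
  sort (fun a b : R => a <= b) [seq x i | i <- enum 'I_n].

Definition leximin_dom (x y : 'I_n -> R) : Prop :=
  exists k : nat, (k < n)%N /\
    (forall j : nat, (j < k)%N -> nth 0 (sorted_entries x) j = nth 0 (sorted_entries y) j) /\
    nth 0 (sorted_entries y) k < nth 0 (sorted_entries x) k.

Definition is_BLO (pi : 'I_n -> R) : Prop :=
  in_core pi /\ forall pi', in_core pi' -> ~ leximin_dom pi' pi.

End CA.

Definition blo_factor (R : realType) (k : nat) : R :=
  4 / (k%:R + 2 + (k %% 2)%:R / k%:R).

(* Main.v *)
(* At a leximin-optimal core point x every bidder i has a bottleneck: a coalition
   T_i containing i whose core constraint is tight and in which x_i is the
   largest entry; otherwise x_i could be raised at the expense of strictly
   larger entries only.  Take a set B of bidders whose bottlenecks cover all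
   bidders and such that each T_i (i in B) has a private element p_i with
   x_{p_i} = x_i.  Summing the tight constraints, every core point y has revenue
   at most sum_j m_j x_j, where m_j is the number of bottlenecks (i in B)
   containing j.  If L = {j : x_j >= t} has s elements, b of which lie in B, then
   only these b bottlenecks meet L, so sum_{j in L} m_j <= b + (s - b) b.
   Optimizing over b and s <= |W| bounds the average of m_j on every level set by
   the inverse of the factor, and summation by parts over the level sets gives
   the inequality.

   For tightness, let all k winners want one item each, worth s = |C| + 1, where
   C is a set of floor(k/2) of the items, and let one losing bidder offer s |C|
   for C together with any one further item.  The core is then cut out by
   y_i + y(C) <= s for i outside C; its leximin optimum gives 1 to every winner,
   whereas the revenue is maximized by giving 0 on C and s elsewhere. *)
Require Import Defs.
From HB Require Import structures.
From mathcomp Require Import all_boot all_order all_algebra.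
From mathcomp Require Import reals.
From mathcomp Require Import zify ring lra.
Import Order.TTheory GRing.Theory Num.Theory.
Local Open Scope ring_scope.

(** * Sorted vectors and leximin comparison *)

Lemma sort_cat_le (R : realType) (s t : seq R) :
  {in s & t, forall a b, a <= b} ->
  sort <=%R (s ++ t) = sort <=%R s ++ sort <=%R t.
Proof.
move=> le_st; apply: le_sorted_eq; first exact: sort_le_sorted.
- rewrite (sorted_pairwise le_trans) pairwise_cat.
  rewrite -!(sorted_pairwise le_trans) !sort_le_sorted !andbT.
  by apply/allrelP => a b; rewrite !mem_sort; apply: le_st.
- by rewrite perm_sort perm_sym perm_cat // perm_sort.
Qed.

Lemma sorted_entries_split (R : realType) (n : nat) (x : 'I_n -> R)
    (D : pred 'I_n) :
  (forall i j, D i -> ~~ D j -> x i <= x j) ->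
  sorted_entries x =
    sort <=%R [seq x i | i <- enum 'I_n & D i] ++
    sort <=%R [seq x i | i <- enum 'I_n & ~~ D i].
Proof.
move=> le_x; rewrite -sort_cat_le; last first.
  move=> a b /mapP[i] + -> /mapP[j] + ->; rewrite !mem_filter.
  by move=> /andP[Di _] /andP[Dj _]; apply: le_x.
apply/(perm_sort_leP (T := R)); rewrite perm_sym -map_cat; apply: perm_map.
by rewrite perm_filterC.
Qed.

(** This criterion avoids computing sorted lists: both begin with the same sorted block, of length
    [#|D|]. The next entry is at most [z i] for [z], because [i] lies outside [D], and exceeds [z i]
    for [x]. *)
Lemma leximin_dom_prefix (R : realType) (n : nat) (x z : 'I_n -> R)
    (D : pred 'I_n) (i : 'I_n) :
  ~~ D i -> (forall j, D j -> x j = z j /\ z j <= z i) ->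
  (forall j, ~~ D j -> z i <= z j /\ z i < x j) ->
  leximin_dom x z.
Proof.
move=> Di xD xC.
have split_x := sorted_entries_split R n x D.
have split_z := sorted_entries_split R n z D.
have eqD : [seq x j | j <- enum 'I_n & D j] = [seq z j | j <- enum 'I_n & D j].
  by apply/eq_in_map => j; rewrite mem_filter => /andP[/xD[]].
have mem_i : i \in [seq j <- enum 'I_n | ~~ D j] by rewrite mem_filter Di mem_enum.
set m := size [seq j <- enum 'I_n | D j].
have sz (y : 'I_n -> R) : size (sort <=%R [seq y j | j <- enum 'I_n & D j]) = m.
  by rewrite size_sort size_map.
have cat_n : (m + size [seq j <- enum 'I_n | ~~ D j] = n)%N.
  by rewrite /m !size_filter count_predC size_enum_ord.
have sizeC : (0 < size [seq j <- enum 'I_n | ~~ D j])%N by case: filter mem_i.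
exists m; split; first by rewrite -[ltnRHS]cat_n -[ltnLHS]addn0 ltn_add2l.
rewrite split_x; last first.
  by move=> j j' /xD[-> le_ji] /xC[_ lt_ij]; apply: le_trans (ltW lt_ij).
rewrite split_z; last by move=> j j' /xD[_ le_ji] /xC[le_ij _]; apply: le_trans le_ij.
rewrite eqD; split=> [j ltjm|]; first by rewrite !nth_cat !sz ltjm.
rewrite !nth_cat !sz ltnn subnn.
set zs := sort _ _; set xs := sort _ _.
have : nth 0 xs 0 \in xs by rewrite mem_nth // size_sort size_map.
rewrite mem_sort => /mapP[j]; rewrite mem_filter => /andP[/xC[_ lt_ij] _ ->].
apply: le_lt_trans lt_ij.
have zi : z i \in zs by rewrite mem_sort map_f.
rewrite -[leRHS](nth_index 0 zi).
by apply: (sorted_leq_nth le_trans le_refl 0 (sort_le_sorted _)) => //;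
  rewrite ?inE ?index_mem // size_sort size_map.
Qed.

Lemma leximin_dom_asym (R : realType) (n : nat) (x y : 'I_n -> R) :
  leximin_dom x y -> ~ leximin_dom y x.
Proof.
move=> [k [_ [eqk ltk]]] [l [_ [eql ltl]]].
case: (ltngtP k l) => kl.
- by rewrite eql ?ltxx in ltk.
- by rewrite eqk ?ltxx in ltl.
- by move: ltk; rewrite kl => /(lt_trans ltl); rewrite ltxx.
Qed.

(** * Bottlenecks of a leximin optimum *)

Lemma ex_pos_lower_bound (R : realType) (I : finType) (f : I -> R) :
  exists2 e, 0 < e & forall i, 0 < f i -> e <= f i.
Proof.
exists (\big[Order.min/1]_(i | 0 < f i) f i).
  by apply: lt_bigmin => [|i //]; exact: ltr01.
by move=> i fi; apply: bigmin_le_cond.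
Qed.

(** The last clause records tightness in the only form used later: the right-hand side of the core
    constraint, which bounds every core point on [T], is attained by [x]. Without a bottleneck, a
    small transfer to [i] from all strictly larger entries stays in the core and dominates [x]. *)
Lemma BLO_bottleneck (R : realType) (n : nat) (M : finType)
    (v : 'I_n -> {set M} -> R) (x : 'I_n -> R) (i : 'I_n) :
  is_BLO v x ->
  exists T : {set 'I_n}, [/\ i \in T, forall j, j \in T -> x j <= x i &
    forall y, in_core v y -> \sum_(j in T) y j <= \sum_(j in T) x j].
Proof.
move=> [[x_ge0 x_core] x_max].
pose c (T : {set 'I_n}) := w v [set: 'I_n] - w v (~: T).
have coreP y (T : {set _}) : in_core v y -> \sum_(j in T) y j <= c T.
  by move=> [_ /(_ (~: T))]; rewrite setCK.
have [/existsP[T /and3P[iT /forall_inP le_T /eqP xT]]|noT] :=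
  boolP [exists T : {set 'I_n}, [&& i \in T, [forall (j | j \in T), x j <= x i]
                   & \sum_(j in T) x j == c T]].
  by exists T; split=> // y /coreP; rewrite xT.
exfalso.
have [e1 e1_gt0 e1P] := ex_pos_lower_bound R _ (fun j => x j - x i).
have [e2 e2_gt0 e2P] := ex_pos_lower_bound R _ (fun T => c T - \sum_(j in T) x j).
(* Halving makes [e] strictly smaller than every positive gap [x j - x i], so that lowered entries
   stay above [x i]; it is also at most every positive slack of a constraint. *)
pose e := Num.min e1 e2 / 2.
have e_gt0 : 0 < e by rewrite divr_gt0 // lt_min e1_gt0.
have le_e1 : Num.min e1 e2 <= e1 by rewrite ge_min lexx.
have le_e2 : Num.min e1 e2 <= e2 by rewrite ge_min lexx orbT.
have ee1 : e < e1 by move: le_e1 e1_gt0 e_gt0; rewrite /e; lra.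
have ee2 : e <= e2 by move: le_e2 e_gt0; rewrite /e; lra.
pose x' j := if j == i then x i + e else if x i < x j then x j - e else x j.
have gap j : x i < x j -> x i < x j - e.
  by rewrite -subr_gt0 => /e1P; move: ee1; lra.
have x'_le j : j != i -> x' j <= x j.
  by rewrite /x' => /negPf->; case: ifP => // _; lra.
apply: (x_max x').
  split=> [j|S].
    rewrite /x'; case: ifP => [_|_]; first by rewrite addr_ge0 // ltW.
    by case: ifP => // /gap lt_ij; apply: le_trans (x_ge0 i) (ltW lt_ij).
  have := x_core S; move: (~: S) (setCK S) => T <-; rewrite -/(c T) => xT.
  have [iT|iT] := boolP (i \in T); last first.
    apply: le_trans xT; apply: ler_sum => j jT; apply: x'_le.
    by apply: contraNneq iT => <-.
  have [tight|slack] := eqVneq (\sum_(j in T) x j) (c T).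
    (* A tight coalition containing [i] is not a bottleneck, so it has a larger entry [j], whose
       loss of [e] pays for the gain of [i]. *)
    have /existsP[j /andP[jT lt_ij]] : [exists j, (j \in T) && (x i < x j)].
      move: noT; apply: contraNT; rewrite negb_exists => /forallP noj.
      apply/existsP; exists T; rewrite iT tight eqxx andbT /=.
      by apply/forall_inP => j jT; have := noj j; rewrite jT leNgt.
    have ji : j != i by apply: contraTneq lt_ij => ->; rewrite ltxx.
    apply: le_trans xT; rewrite (bigD1 i) //= (bigD1 j) ?jT //=.
    rewrite [leRHS](bigD1 i) //= [\sum_(k in T | k != i) x k](bigD1 j) ?jT //=.
    rewrite {1 2}/x' eqxx (negPf ji) lt_ij.
    have : \sum_(k | (k \in T) && (k != i) && (k != j)) x' k <=
           \sum_(k | (k \in T) && (k != i) && (k != j)) x k.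
      by apply: ler_sum => k /andP[/andP[_ /x'_le]].
    lra.
  have lt_xT : 0 < c T - \sum_(j in T) x j by rewrite subr_gt0 lt_neqAle slack.
  move/e2P: lt_xT; rewrite (bigD1 i) //= [\sum_(j in T) x' j](bigD1 i) //=.
  rewrite {1}/x' eqxx.
  have : \sum_(k in T | k != i) x' k <= \sum_(k in T | k != i) x k.
    by apply: ler_sum => k /andP[_ /x'_le].
  move: ee2; lra.
(* The common prefix consists of the entries that the transfer leaves unchanged. *)
apply: (leximin_dom_prefix _ _ _ _ (fun j => (j != i) && (x j <= x i)) i).
- by rewrite eqxx.
- by move=> j /andP[ji xji]; rewrite /x' (negPf ji) ltNge xji.
- move=> j; rewrite negb_and negbK -ltNge /x'.
  case: eqP => [-> _|_ /= lt_ij]; first by split=> //; lra.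
  by rewrite lt_ij; split; [exact: ltW|exact: gap].
Qed.

(** * Private covers and level sets *)

(* B minimizes a potential in which one entry outweighs all entries of strictly
   lower level together: a bidder i of B without private element of its own level
   could be replaced by the members of T_i of strictly lower level. *)
Lemma private_cover (R : realType) (I : finType) (x : I -> R)
    (T : I -> {set I}) :
  (forall i, i \in T i) -> (forall i j, j \in T i -> x j <= x i) ->
  exists B : {set I}, (forall j, exists2 i, i \in B & j \in T i) /\
    (forall i, i \in B -> exists p, [/\ p \in T i, x p = x i &
       forall i', i' \in B -> p \in T i' -> i' = i]).
Proof.
move=> T_refl T_le.
pose covers (B : {set I}) := [forall j, [exists i, (i \in B) && (j \in T i)]].
have coversT : covers [set: I].
  by apply/forallP => j; apply/existsP; exists j; rewrite in_setT T_refl.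
pose rank i := #|[set j | x j < x i]|.
pose pot (B : {set I}) := (\sum_(i in B) #|I|.+1 ^ rank i)%N.
case: (arg_minnP pot coversT) => B /forallP covB minB.
exists B; split=> [j|i iB].
  by have /existsP[i /andP[]] := covB j; exists i.
pose priv p := [&& p \in T i, x p == x i &
  [forall (i' | i' \in B), (p \in T i') ==> (i' == i)]].
case: (boolP [exists p, priv p]) => [/existsP[p /and3P[pT /eqP xp /forall_inP pB]]|].
  by exists p; split=> // i' i'B pT'; apply/eqP/(implyP (pB _ i'B)).
rewrite negb_exists => /forallP nopriv; exfalso.
pose A := [set j | x j < x i].
have : covers (B :\ i :|: A).
  apply/forallP => j; have /existsP[i' /andP[i'B jT']] := covB j.
  have [ei'|ni'] := eqVneq i' i; last first.
    by apply/existsP; exists i'; rewrite !inE ni' i'B jT'.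
  move: jT'; rewrite {}ei' => jT.
  have [ltj|] := boolP (x j < x i).
    by apply/existsP; exists j; rewrite !inE ltj orbT T_refl.
  rewrite -leNgt => lej.
  have /eqP xj : x j == x i by rewrite eq_le lej T_le.
  (* An element of [T i] at the level of [i] is not private, hence some other member of [B] still
     covers it after [i] is removed. *)
  have := nopriv j; rewrite /priv jT xj eqxx /= negb_forall_in.
  case/exists_inP => i2 i2B; rewrite negb_imply => /andP[jT2 ni2].
  by apply/existsP; exists i2; rewrite !inE ni2 i2B jT2.
move/minB; apply/negP; rewrite -ltnNge /pot.
rewrite [ltnRHS](bigD1 i) //=.
apply: (@leq_ltn_trans (\sum_(j in A) #|I|.+1 ^ rank j +
                        \sum_(j in B | j != i) #|I|.+1 ^ rank j)%N).
  rewrite (bigID [in A]) /=; apply: leq_add.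
    rewrite big_mkcond [leqRHS]big_mkcond; apply: leq_sum => j _.
    by case: ifP => [/andP[_ ->]|].
  rewrite big_mkcond [leqRHS]big_mkcond; apply: leq_sum => j _.
  rewrite !inE; case: ifP => // /andP[/orP[/andP[-> ->]//|->]//].
rewrite ltn_add2r.
(* For nonempty [A] the rank of [i] is positive, and the at most [#|I|] members of [A] have smaller
   rank, so together they weigh less than [i] in base [#|I|.+1]. *)
have [A0|[j0 j0A]] := set_0Vmem A; first by rewrite A0 big_set0 expn_gt0.
have rank_gt0 : (0 < rank i)%N by rewrite card_gt0; apply/set0Pn; exists j0.
apply: (@leq_ltn_trans (\sum_(j in A) #|I|.+1 ^ (rank i).-1)%N).
  apply: leq_sum => j; rewrite inE => ltji; rewrite leq_pexp2l //.
  rewrite -ltnS prednK //; apply: proper_card; apply/properP; split.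
    by apply/subsetP => l; rewrite !inE => /lt_trans; apply.
  by exists j; rewrite inE ?ltxx.
rewrite sum_nat_const -[in ltnRHS](prednK rank_gt0) expnS.
by rewrite ltn_pmul2r ?expn_gt0 // ltnS max_card.
Qed.

(* Summation by parts over the level sets: lower all positive entries of x by
   the smallest one. *)
Lemma layer_sum_ge0 (R : realType) (I : finType) (x f : I -> R) :
  (forall i, 0 <= x i) ->
  (forall t, 0 < t -> 0 <= \sum_(i | t <= x i) f i) ->
  0 <= \sum_i f i * x i.
Proof.
have [m le_m] := ubnP #|[set i | 0 < x i]|.
elim: m x le_m => // m IHm x le_m x_ge0 f_ge0.
have [pos0|[i0 i0pos]] := set_0Vmem [set i | 0 < x i].
  rewrite big1 // => i _; have := in_set0 i; rewrite -pos0 inE lt_def x_ge0 andbT.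
  by move/negbFE/eqP->; rewrite mulr0.
have x0_gt0 : 0 < x i0 by rewrite inE in i0pos.
have [i xi_gt0 xi_min] := arg_minP (P := fun i => 0 < x i) x x0_gt0.
pose x' j := if 0 < x j then x j - x i else 0.
have xi_le j : 0 < x j -> x i <= x j by exact: xi_min.
have -> : \sum_j f j * x j = \sum_j f j * x' j + x i * \sum_(j | x i <= x j) f j.
  rewrite mulr_sumr [X in _ + X]big_mkcond -big_split; apply: eq_bigr => j _ /=.
  rewrite /x'; case: ltP => [/xi_le->|xj]; first by ring.
  have /eqP-> : x j == 0 by rewrite eq_le xj x_ge0.
  by rewrite leNgt xi_gt0 /= !mulr0 addr0.
apply: addr_ge0; last by rewrite mulr_ge0 // f_ge0.
apply: IHm.
- rewrite ltnS in le_m; apply: leq_trans le_m; apply: proper_card.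
  apply/properP; split; last first.
    by exists i; rewrite inE // /x' xi_gt0 subrr ltxx.
  by apply/subsetP => j; rewrite !inE /x'; case: (ltP 0 (x j)); rewrite ?ltxx.
- by move=> j; rewrite /x'; case: ifP => // /xi_le; rewrite subr_ge0.
(* For positive [t], the level set of [x'] at [t] is that of [x] at [t + x i]. *)
- move=> t t_gt0; have /f_ge0 : 0 < t + x i by rewrite addr_gt0.
  rewrite (eq_bigl (fun j => t <= x' j)) // => j; rewrite /x'.
  case: ltP => [_|xj]; first by rewrite lerBrDr.
  by apply/idP/idP; move: t_gt0 xi_gt0 xj; lra.
Qed.

(** * Arithmetic of the factor *)

(** With d = s - b, right side minus left side is (d - b + 1)^2 - 1 + s mod 2. The square vanishes
    only if d - b = -1, and then s is odd. *)
Lemma quarter_square_le (b s : nat) : (b <= s)%N ->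
  (4 * (b + (s - b) * b) <= s * (s + 2) + s %% 2)%N.
Proof.
move=> /subnK <-; move: (s - b)%N => d; rewrite addnK.
have [|] := leqP b d => [/subnK<-|/ltnW/subnK<-].
  move: (d - b)%N => e; have -> : ((e + b + b) %% 2 = e %% 2)%N by lia.
  have : (e = 0 \/ e %% 2 = 1 \/ 2 <= e)%N by lia.
  nia.
move: (b - d)%N => e; have -> : ((d + (e + d)) %% 2 = e %% 2)%N by lia.
have : (e = 0 \/ e %% 2 = 1 \/ 2 <= e)%N by lia.
nia.
Qed.

(** After division by s the previous bound is s + 2 + (s mod 2)/s. It is nondecreasing in s, because
    the parity term is at most 1: for s < k it is at most s + 3 <= k + 2. *)
Lemma quarter_square_ratio (b s k : nat) : (b <= s)%N -> (s <= k)%N ->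
  (4 * (b + (s - b) * b) * k <= (k * (k + 2) + k %% 2) * s)%N.
Proof.
move=> /quarter_square_le le_b le_sk.
apply: leq_trans (leq_mul le_b (leqnn k)) _.
have [->|ne_sk] := eqVneq s k; first exact: leqnn.
have := ltn_pmod s (isT : 0 < 2)%N.
have lt_sk : (s < k)%N by rewrite ltn_neqAle ne_sk.
case: s {le_b le_sk ne_sk} lt_sk => [|s]; first by rewrite mod0n.
nia.
Qed.

(** * The revenue inequality *)

Lemma le_w (R : realType) (n : nat) (M : finType) (v : 'I_n -> {set M} -> R)
    (S : {set 'I_n}) (a : 'I_n -> {set M}) :
  feasible a -> \sum_(i in S) v i (a i) <= w v S.
Proof.
move=> feas_a; have feas_fa : feasible [ffun i => a i].
  apply/forallP => i; apply/forallP => j; rewrite !ffunE.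
  by have /forallP/(_ j) := forallP feas_a i.
apply: le_trans (le_bigmax_cond _ _ feas_fa).
by apply: ler_sum => i _; rewrite ffunE.
Qed.

(** The optimal allocation gives a loser nothing, so the other bidders alone already reach w(N), and
    the core constraint for their coalition leaves 0 to the loser. *)
Lemma core_loser0 (R : realType) (n : nat) (M : finType)
    (v : 'I_n -> {set M} -> R) (a : 'I_n -> {set M}) (x : 'I_n -> R) (j : 'I_n) :
  valuation_ok v -> optimal_alloc v a -> in_core v x -> j \notin winners a ->
  x j = 0.
Proof.
move=> [_ v0] [feas_a opt_a] [x_ge0 x_core]; rewrite inE negbK => /eqP aj.
apply/eqP; rewrite eq_le x_ge0 andbT.
have := x_core (~: [set j]); rewrite setCK big_set1 => /le_trans; apply.
rewrite subr_le0 -opt_a; apply: le_trans (le_w _ _ _ _ _ _ feas_a).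
rewrite (bigD1 j) ?inE //= aj v0 add0r le_eqVlt; apply/orP; left.
by apply/eqP/eq_bigl => i; rewrite !inE.
Qed.

(** [L] stands for a level set: only sets [T i] with [i] in [L] meet it. The private elements form a
    subset [P] of [L] of size [#|B :&: L|], each counted at most once; any other element of [L] is
    counted at most [#|B :&: L|] times. *)
Lemma private_cover_count (n : nat) (T : 'I_n -> {set 'I_n}) (B L : {set 'I_n})
    (p : 'I_n -> 'I_n) :
  (forall i j, j \in T i -> j \in L -> i \in L) ->
  (forall i, i \in B -> i \in L -> p i \in L) ->
  (forall i, i \in B -> p i \in T i) ->
  (forall i i', i \in B -> i' \in B -> p i \in T i' -> i' = i) ->
  (#|B :&: L| <= #|L|)%N /\
  (\sum_(j in L) #|[set i in B | j \in T i]| <=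
     #|B :&: L| + (#|L| - #|B :&: L|) * #|B :&: L|)%N.
Proof.
move=> TL pL pT p_priv; pose P := p @: (B :&: L).
have cardP : #|P| = #|B :&: L|.
  apply: card_in_imset => i i' /setIP[iB _] /setIP[i'B _] epi.
  by apply: (p_priv i' i) => //; rewrite -epi pT.
have PL : P \subset L.
  by apply/subsetP => _ /imsetP[i /setIP[iB iL] ->]; apply: pL.
split; first by rewrite -cardP subset_leq_card.
rewrite (big_setID P) /= (setIidPr PL) -{1}cardP; apply: leq_add.
  rewrite -sum1_card; apply: leq_sum => _ /imsetP[i /setIP[iB iL] ->].
  rewrite -(cards1 i); apply: subset_leq_card; apply/subsetP => i'.
  by rewrite !inE => /andP[i'B /p_priv->].
have -> : (#|L| - #|B :&: L| = #|L :\: P|)%N.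
  by rewrite cardsD (setIidPr PL) cardP.
rewrite -sum_nat_const.
apply: leq_sum => j /setDP[jL _]; apply: subset_leq_card; apply/subsetP => i.
by rewrite !inE => /andP[-> /TL->].
Qed.

Lemma blo_factorVE (R : realType) (k : nat) : (0 < k)%N ->
  (blo_factor R k)^-1 = (k * (k + 2) + k %% 2)%:R / (4 * k)%:R.
Proof.
move=> k_gt0; have k0 : k%:R != 0 :> R by rewrite pnatr_eq0 -lt0n.
rewrite /blo_factor invf_div natrD !natrM natrD.
by field.
Qed.

Lemma BLO_revenue_ge (R : realType) (n : nat) (M : finType)
    (v : 'I_n -> {set M} -> R) (x y : 'I_n -> R) (k : nat) :
  is_BLO v x -> in_core v y -> (0 < k)%N -> (#|[set j | (0 < x j)%R]| <= k)%N ->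
  blo_factor R k * revenue y <= revenue x.
Proof.
move=> BLOx y_core k_gt0 le_k; have [[x_ge0 _] _] := BLOx.
have [T TP] := fin_all_exists (fun i => BLO_bottleneck R n M v x i BLOx).
have T_refl i : i \in T i by case: (TP i).
have T_le i j : j \in T i -> x j <= x i by case: (TP i) => _ + _; apply.
have T_opt i : \sum_(j in T i) y j <= \sum_(j in T i) x j.
  by case: (TP i) => _ _; apply.
have [B [covB /(_ _) privB]] := private_cover R _ x T T_refl T_le.
have /fin_all_exists[p pP] : forall i, exists p, i \in B ->
    [/\ p \in T i, x p = x i & forall i', i' \in B -> p \in T i' -> i' = i].
  move=> i; have [/privB[p pP]|_] := boolP (i \in B); first by exists p.
  by exists i.
pose m j := #|[set i in B | j \in T i]|.
have sum_m (z : 'I_n -> R) :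
    \sum_(i in B) \sum_(j in T i) z j = \sum_j (m j)%:R * z j.
  rewrite (exchange_big_dep xpredT) //=; apply: eq_bigr => j _.
  rewrite sumr_const mulr_natl /m; congr (_ *+ _).
  by apply: eq_card => i; rewrite !inE.
(* Since [B] covers, every [m j] is at least 1, so the revenue of [y] is at most its total over the
   bottlenecks, where [x] is at least as large. *)
have le_y : revenue y <= \sum_j (m j)%:R * x j.
  rewrite -sum_m; apply: (@le_trans _ _ (\sum_(i in B) \sum_(j in T i) y j)).
    rewrite sum_m; apply: ler_sum => j _; rewrite ler_peMl ?ler1n //.
      by case: y_core.
    rewrite card_gt0; apply/set0Pn; have [i iB jT] := covB j.
    by exists i; rewrite inE iB.
  exact: ler_sum.
set F := blo_factor R k.
have F_gt0 : 0 < F.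
  by rewrite divr_gt0 ?ltr0n // ltr_pwDl ?addr_gt0 ?divr_ge0 ?ler0n ?ltr0n.
have FV : F^-1 = (k * (k + 2) + k %% 2)%:R / (4 * k)%:R by exact: blo_factorVE.
have : 0 <= \sum_j (F^-1 - (m j)%:R) * x j.
  apply: layer_sum_ge0 => // t t_gt0; pose L := [set j | t <= x j].
  have [] := private_cover_count n T B L p.
  - by move=> i j /T_le le_ji; rewrite !inE => /le_trans; apply.
  - by move=> i /pP[_ epi _]; rewrite !inE epi.
  - by move=> i /pP[].
  - by move=> i i' /pP[_ _]; apply.
  set b := #|B :&: L|; set s := #|L| => le_bs le_m.
  (* As [t] is positive, the level set lies in the support of [x]. *)
  have le_sk : (s <= k)%N.
    apply: leq_trans le_k; apply: subset_leq_card; apply/subsetP => j.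
    by rewrite !inE; apply: lt_le_trans.
  rewrite sumrB sumr_const subr_ge0 -natr_sum.
  have -> : (\sum_(j | (t <= x j)%R) m j = \sum_(j in L) m j)%N.
    by apply: eq_bigl => j; rewrite inE.
  have -> : #|[pred j | t <= x j]| = s by apply: eq_card => j; rewrite !inE.
  rewrite FV -[leRHS]mulr_natr mulrAC ler_pdivlMr ?ltr0n ?muln_gt0 //.
  rewrite -!natrM ler_nat; apply: leq_trans (quarter_square_ratio _ _ _ le_bs le_sk).
  by rewrite mulnCA mulnA leq_mul2r leq_mul2l le_m !orbT.
under eq_bigr do rewrite mulrBl.
rewrite sumrB subr_ge0 -mulr_sumr => le_x.
by rewrite mulrC -ler_pdivlMr // mulrC; apply: le_trans le_y le_x.
Qed.

(** * The auctions attaining equality *)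

Lemma sum_in_recl (R : realType) (k : nat) (S : {set 'I_k.+1}) (f : 'I_k.+1 -> R) :
  \sum_(i in S) f i = (if ord0 \in S then f ord0 else 0) +
    \sum_(j : 'I_k) (if lift ord0 j \in S then f (lift ord0 j) else 0).
Proof. by rewrite big_mkcond big_ord_recl. Qed.

(** The complement of [B] is the set C of the overview. The price |C| + 1 makes the constraints y_i
    + y(C) <= s tight when every winner gets 1. *)
Definition bundle_price (R : realType) (k : nat) (B : {set 'I_k}) : R :=
  #|~: B|.+1%:R.

(* Bidder [lift ord0 j] only wants item [j]; bidder [ord0] wants all items
   outside [B] together with at least one item of [B]. *)
Definition bundle_auction (R : realType) (k : nat) (B : {set 'I_k})
    (i : 'I_k.+1) (A : {set 'I_k}) : R :=
  if unlift ord0 i is Some j then (if j \in A then bundle_price R k B else 0)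
  else if (~: B \subset A) && (A :&: B != set0)
       then bundle_price R k B * #|~: B|%:R else 0.

Definition singleton_alloc (k : nat) (i : 'I_k.+1) : {set 'I_k} :=
  if unlift ord0 i is Some j then [set j] else set0.

Lemma bundle_auction0 (R : realType) (k : nat) (B A : {set 'I_k}) :
  bundle_auction R k B ord0 A =
    if (~: B \subset A) && (A :&: B != set0)
    then bundle_price R k B * #|~: B|%:R else 0.
Proof. by rewrite /bundle_auction unlift_none. Qed.

Lemma bundle_auction_lift (R : realType) (k : nat) (B A : {set 'I_k}) (j : 'I_k) :
  bundle_auction R k B (lift ord0 j) A = if j \in A then bundle_price R k B else 0.
Proof. by rewrite /bundle_auction liftK. Qed.

Lemma singleton_alloc0 (k : nat) : singleton_alloc k ord0 = set0.
Proof. by rewrite /singleton_alloc unlift_none. Qed.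

Lemma singleton_alloc_lift (k : nat) (j : 'I_k) :
  singleton_alloc k (lift ord0 j) = [set j].
Proof. by rewrite /singleton_alloc liftK. Qed.

Lemma bundle_price_gt0 (R : realType) (k : nat) (B : {set 'I_k}) :
  0 < bundle_price R k B.
Proof. by rewrite ltr0n. Qed.

Lemma bundle_auction_ok (R : realType) (k : nat) (B : {set 'I_k}) :
  valuation_ok (bundle_auction R k B).
Proof.
have s_ge0 := ltW (bundle_price_gt0 R k B).
split=> [i A|i]; rewrite /bundle_auction; case: unliftP => [j|] _.
- by case: ifP.
- by case: ifP => // _; rewrite mulr_ge0 ?ler0n.
- by rewrite inE.
- by rewrite set0I eqxx andbF.
Qed.

Lemma feasible_singleton (k : nat) : feasible (@singleton_alloc k).
Proof.
apply/forallP => i; apply/forallP => j; apply/implyP; rewrite /singleton_alloc.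
case: unliftP => [i' ->|_ _]; last by rewrite disjoints_subset sub0set.
case: unliftP => [j' ->|_ _]; last by rewrite disjoint_sym disjoints_subset sub0set.
by rewrite (inj_eq lift_inj) disjoints1 inE.
Qed.

Lemma winners_singleton (k : nat) : #|winners (@singleton_alloc k)| = k.
Proof.
have -> : winners (@singleton_alloc k) = [set lift ord0 j | j : 'I_k].
  apply/setP => i; rewrite inE /singleton_alloc; case: unliftP => [j ->|->].
    by rewrite imset_f // -card_gt0 cards1.
  by rewrite eqxx; apply/esym/negbTE/imsetP => -[j _ /eqP]; rewrite (negPf (neq_lift _ _)).
by rewrite card_imset ?card_ord //; apply: lift_inj.
Qed.

Lemma bundle_singleton_sum (R : realType) (k : nat) (B : {set 'I_k})
    (S : {set 'I_k.+1}) : (forall j, lift ord0 j \in S) ->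
  \sum_(i in S) bundle_auction R k B i (singleton_alloc k i) =
    bundle_price R k B * k%:R.
Proof.
move=> jS; rewrite sum_in_recl bundle_auction0 singleton_alloc0.
rewrite set0I eqxx andbF if_same add0r.
under eq_bigr => j _ do
  rewrite jS bundle_auction_lift singleton_alloc_lift inE eqxx.
by rewrite sumr_const card_ord mulr_natr.
Qed.

(** This serves both to compute w(N), with [y] zero, and to derive all core constraints from those
    indexed by [B]. Each item contributes at most s. If [ord0] wins a bundle containing C and some
    [i] in [B], these items together contribute at most s, which makes room for its value s |C|. *)
Lemma bundle_upper_bound (R : realType) (k : nat) (B : {set 'I_k})
    (S : {set 'I_k.+1}) (a : 'I_k.+1 -> {set 'I_k}) (y : 'I_k -> R) :
  B != set0 -> feasible a -> (forall j, 0 <= y j) ->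
  (forall i, i \in B -> y i + \sum_(j in ~: B) y j <= bundle_price R k B) ->
  \sum_(i in S) bundle_auction R k B i (a i) +
    \sum_j (if lift ord0 j \in S then 0 else y j) <= bundle_price R k B * k%:R.
Proof.
move=> /set0Pn[i0 i0B] feas_a y_ge0 y_le.
set s := bundle_price R k B; have s_gt0 : 0 < s := bundle_price_gt0 R k B.
have yC_ge0 : 0 <= \sum_(j in ~: B) y j by apply: sumr_ge0.
have y_le_s j : y j <= s.
  have [jB|jB] := boolP (j \in B); first by have := y_le j jB; rewrite -/s; lra.
  have := y_le i0 i0B; rewrite (bigD1 j) ?inE //= -/s.
  have := y_ge0 i0; have : 0 <= \sum_(i in ~: B | i != j) y i by apply: sumr_ge0.
  lra.
rewrite sum_in_recl -addrA -big_split /=.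
pose u j := if lift ord0 j \in S
  then bundle_auction R k B (lift ord0 j) (a (lift ord0 j)) else y j.
rewrite [X in _ + X](eq_bigr u); last first.
  by move=> j _; rewrite /u; case: ifP; rewrite ?addr0 ?add0r.
have u_le j : u j <= s.
  rewrite /u bundle_auction_lift -/s; case: ifP => // _.
  by case: ifP => // _; exact: ltW.
have cardk : k = (#|B| + #|~: B|)%N by rewrite cardsC card_ord.
have sum_s (A : {set 'I_k}) : \sum_(j in A) u j <= s * #|A|%:R.
  rewrite mulr_natr -sumr_const; exact: ler_sum.
have no_bundle : \sum_j u j <= s * k%:R.
  have := sum_s [set: 'I_k]; rewrite cardsT card_ord.
  by under eq_bigl do rewrite inE.
case: ifP => [_|_]; last by rewrite add0r.
rewrite bundle_auction0.
case: ifP => [/andP[Ca /set0Pn[i /setIP[ia iB]]]|_]; last by rewrite add0r.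
(* A bidder whose item went to [ord0] has value 0 if it belongs to [S], and otherwise contributes
   exactly [y j]. *)
have u_le_y j : j \in a ord0 -> u j <= y j.
  move=> ja; rewrite /u bundle_auction_lift; case: ifP => // _.
  have /forallP/(_ (lift ord0 j)) := forallP feas_a ord0.
  rewrite neq_lift /= => /disjoint_setI0/setP/(_ j).
  by rewrite !inE ja /= => ->.
have -> : \sum_j u j = \sum_(j in ~: B) u j + (u i + \sum_(j in B :\ i) u j).
  rewrite -big_setD1 //= (bigID [in B]) /= addrC; congr (_ + _).
  by apply: eq_bigl => j; rewrite inE.
have : \sum_(j in ~: B) u j + u i <= s.
  apply: le_trans (y_le i iB); rewrite addrC lerD ?u_le_y //.
  by apply: ler_sum => j jC; apply/u_le_y/(subsetP Ca).
have := sum_s (B :\ i).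
have -> : k%:R = #|~: B|%:R + 1 + #|B :\ i|%:R :> R.
  by rewrite {1}cardk (cardsD1 i B) iB natr1 -natrD; congr _%:R; lia.
rewrite -/s; lra.
Qed.

Lemma bundle_w_total (R : realType) (k : nat) (B : {set 'I_k}) : B != set0 ->
  w (bundle_auction R k B) [set: 'I_k.+1] = bundle_price R k B * k%:R.
Proof.
move=> B0; apply/eqP; rewrite eq_le; apply/andP; split.
  apply: bigmax_le => [|a feas_a].
    by rewrite mulr_ge0 ?ler0n // ltW // bundle_price_gt0.
  rewrite -[leLHS]addr0.
  have zero_le i : i \in B -> 0 + \sum_(j in ~: B) 0 <= bundle_price R k B.
    by rewrite big1 // addr0 ltW // bundle_price_gt0.
  apply: le_trans (bundle_upper_bound R k B [set: _] a (fun=> 0) B0 feas_a _ zero_le) => //.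
  by rewrite lerD2l big1 // => j _; rewrite if_same.
rewrite -(bundle_singleton_sum R k B [set: _]) => [|j]; last by rewrite inE.
exact/le_w/feasible_singleton.
Qed.

Lemma bundle_optimal (R : realType) (k : nat) (B : {set 'I_k}) : B != set0 ->
  optimal_alloc (bundle_auction R k B) (singleton_alloc k).
Proof.
move=> B0; split; first exact: feasible_singleton.
rewrite bundle_w_total // bundle_singleton_sum // => j; exact: in_setT.
Qed.

Lemma bundle_coreP (R : realType) (k : nat) (B : {set 'I_k}) (y : 'I_k.+1 -> R) :
  B != set0 ->
  in_core (bundle_auction R k B) y <->
  [/\ forall i, 0 <= y i, y ord0 = 0 &
      forall i, i \in B -> y (lift ord0 i) + \sum_(j in ~: B) y (lift ord0 j)
                           <= bundle_price R k B].
Proof.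
move=> B0; split=> [y_core|[y_ge0 y0 y_le]].
  have [y_ge0 y_w] := y_core; split=> // [|i iB].
    apply: core_loser0 (bundle_auction_ok R k B) (bundle_optimal R k B B0) y_core _.
    by rewrite inE singleton_alloc0 eqxx.
  (* The bidders outside [S] are those of [i] and C. Serving [ord0] with [i] and C, and the rest of
     [B] individually, gives [S] value s (k - 1), so the others get at most s. *)
  pose S := [set l : 'I_k.+1 | if unlift ord0 l is Some j then j \in B :\ i else true].
  pose a (l : 'I_k.+1) := if unlift ord0 l is Some j
    then if j \in B :\ i then [set j] else set0 else i |: ~: B.
  have feas_a : feasible a.
    apply/forallP => l; apply/forallP => l'; apply/implyP; rewrite /a.
    case: unliftP => [j ->|->]; case: unliftP => [j' ->|->]; rewrite ?eqxx //.
    - rewrite (inj_eq lift_inj) => jj'.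
      case: ifP => _; last by rewrite disjoints_subset sub0set.
      rewrite disjoints1; case: ifP => _; rewrite inE //.
    - case: ifP => [|_]; last by rewrite disjoints_subset sub0set.
      by rewrite disjoints1 !inE => /andP[/negPf-> ->].
    - rewrite disjoint_sym; case: ifP => [|_]; last by rewrite disjoints_subset sub0set.
      by rewrite disjoints1 !inE => /andP[/negPf-> ->].
  have := le_w _ _ _ (bundle_auction R k B) S a feas_a.
  have := y_w S; rewrite bundle_w_total // !sum_in_recl !inE unlift_none /=.
  rewrite bundle_auction0 {1 2}/a unlift_none subsetUr /=.
  have -> : (i |: ~: B) :&: B != set0 by apply/set0Pn; exists i; rewrite !inE eqxx iB.
  under eq_bigr => j _ do rewrite !inE liftK.
  under [X in _ -> _ + X <= _ -> _]eq_bigr => j _ do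
    rewrite !inE bundle_auction_lift /a liftK.
  rewrite add0r.
  have -> : \sum_j (if j \notin B :\ i then y (lift ord0 j) else 0) =
            y (lift ord0 i) + \sum_(j in ~: B) y (lift ord0 j).
    rewrite -big_mkcond (bigD1 i) ?inE ?eqxx //=; congr (_ + _); apply: eq_bigl => j.
    by rewrite !inE; have [->|] := eqVneq j i; rewrite ?iB ?andbF ?andbT.
  have -> : \sum_j (if j \in B :\ i then
      if j \in (if j \in B :\ i then [set j] else set0)
      then bundle_price R k B else 0 else 0) = bundle_price R k B * #|B :\ i|%:R.
    rewrite mulr_natr -sumr_const [RHS]big_mkcond; apply: eq_bigr => j _.
    by case: (j \in B :\ i) => //=; rewrite inE eqxx.
  have -> : k%:R = #|~: B|%:R + 1 + #|B :\ i|%:R :> R.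
    rewrite -{1}(card_ord k) -(cardsC B) (cardsD1 i B) iB natr1 -natrD.
    by congr _%:R; lia.
  lra.
split=> // S; rewrite bundle_w_total // lerBrDr addrC -lerBrDr.
have bound a (feas_a : feasible a) := bundle_upper_bound R k B S a
  (y \o lift ord0) B0 feas_a (fun j => y_ge0 _) y_le.
have -> : \sum_(i in ~: S) y i =
    \sum_j (if lift ord0 j \in S then 0 else (y \o lift ord0) j).
  rewrite sum_in_recl y0 if_same add0r; apply: eq_bigr => j _.
  by rewrite inE; case: (_ \in S).
apply: bigmax_le => [|a /bound]; last by rewrite lerBrDr.
(* The maximum in [w] starts from 0, so 0 must satisfy the bound too; it does because the singleton
   allocation has nonnegative value. *)
have := bound _ (feasible_singleton k).
set X := \sum_(i in S) _; have : 0 <= X; last by lra.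
by apply: sumr_ge0 => i _; case: (bundle_auction_ok R k B).
Qed.

Lemma revenue_recl (R : realType) (k : nat) (y : 'I_k.+1 -> R) :
  y ord0 = 0 -> revenue y = \sum_(j : 'I_k) y (lift ord0 j).
Proof. by move=> y0; rewrite /revenue big_ord_recl y0 add0r. Qed.

(** Summing the constraints over [B] counts y(C) [#|B|] times, hence at least once. *)
Lemma bundle_core_revenue_le (R : realType) (k : nat) (B : {set 'I_k})
    (y : 'I_k.+1 -> R) : B != set0 -> in_core (bundle_auction R k B) y ->
  revenue y <= bundle_price R k B * #|B|%:R.
Proof.
move=> B0 /(bundle_coreP _ _ _ _ B0)[y_ge0 y0 y_le]; rewrite revenue_recl //.
rewrite (bigID [in B]) /= mulr_natr -sumr_const.
apply: le_trans (ler_sum _ y_le); rewrite big_split /= lerD2l sumr_const.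
rewrite (eq_bigl [in ~: B]) => [|j]; last by rewrite inE.
by rewrite -[leRHS]mulr_natr ler_peMr ?ler1n ?card_gt0 // sumr_ge0.
Qed.

Definition bundle_MRC (R : realType) (k : nat) (B : {set 'I_k}) (i : 'I_k.+1) : R :=
  if unlift ord0 i is Some j then (if j \in B then bundle_price R k B else 0) else 0.

Lemma bundle_MRC_core (R : realType) (k : nat) (B : {set 'I_k}) : B != set0 ->
  in_core (bundle_auction R k B) (bundle_MRC R k B).
Proof.
move=> B0; apply/bundle_coreP => //; split=> [i||i iB]; rewrite /bundle_MRC.
- by case: unlift => // j; case: ifP => // _; rewrite ltW ?bundle_price_gt0.
- by rewrite unlift_none.
- rewrite liftK iB big1 ?addr0 // => j; rewrite liftK inE.
  by case: (j \in B).
Qed.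

Lemma bundle_MRC_revenue (R : realType) (k : nat) (B : {set 'I_k}) :
  revenue (bundle_MRC R k B) = bundle_price R k B * #|B|%:R.
Proof.
rewrite revenue_recl ?/bundle_MRC ?unlift_none // mulr_natr -sumr_const.
by rewrite [RHS]big_mkcond; apply: eq_bigr => j _; rewrite liftK.
Qed.

Definition bundle_BLO (R : realType) (k : nat) (i : 'I_k.+1) : R :=
  if unlift ord0 i is Some _ then 1 else 0.

Lemma bundle_BLO0 (R : realType) (k : nat) : bundle_BLO R k ord0 = 0.
Proof. by rewrite /bundle_BLO unlift_none. Qed.

Lemma bundle_BLO_lift (R : realType) (k : nat) (j : 'I_k) :
  bundle_BLO R k (lift ord0 j) = 1.
Proof. by rewrite /bundle_BLO liftK. Qed.

Lemma bundle_BLO_core (R : realType) (k : nat) (B : {set 'I_k}) : B != set0 ->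
  in_core (bundle_auction R k B) (bundle_BLO R k).
Proof.
move=> B0; apply/bundle_coreP => //; split=> [i||i iB].
- by rewrite /bundle_BLO; case: unlift.
- exact: bundle_BLO0.
- rewrite bundle_BLO_lift (eq_bigr (fun=> 1)) => [|j _].
    by rewrite sumr_const addrC natr1.
  exact: bundle_BLO_lift.
Qed.

Lemma bundle_BLO_revenue (R : realType) (k : nat) :
  revenue (bundle_BLO R k) = k%:R.
Proof.
rewrite revenue_recl ?bundle_BLO0 //.
under eq_bigr do rewrite bundle_BLO_lift.
by rewrite sumr_const card_ord.
Qed.

(** This alternative yields both the optimality of [bundle_BLO] and its uniqueness, so that the
    equality holds for every BLO outcome. *)
Lemma bundle_BLO_dom (R : realType) (k : nat) (B : {set 'I_k})
    (z : 'I_k.+1 -> R) : B != set0 -> in_core (bundle_auction R k B) z ->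
  z =1 bundle_BLO R k \/ leximin_dom (bundle_BLO R k) z.
Proof.
move=> B0 /(bundle_coreP _ _ _ _ B0)[z_ge0 z0 z_le].
have [/existsP[j0 lt_j0]|z_ge1] := boolP [exists j, z (lift ord0 j) < 1].
  right; have [i lt_i min_i] :=
    arg_minP (P := fun j => z (lift ord0 j) < 1) (fun j => z (lift ord0 j)) lt_j0.
  apply: (leximin_dom_prefix _ _ _ _ (pred1 ord0) (lift ord0 i)).
  - by [].
  - by move=> l /eqP->; rewrite bundle_BLO0 z0.
  - move=> l /=; case: (unliftP ord0 l) => [j ->|->]; last by rewrite eqxx.
    rewrite bundle_BLO_lift; split=> //.
    have [/min_i//|ge1] := ltP (z (lift ord0 j)) 1.
    exact: le_trans (ltW lt_i) ge1.
have {}z_ge1 j : 1 <= z (lift ord0 j).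
  by move: z_ge1; rewrite negb_exists => /forallP/(_ j); rewrite -leNgt.
left=> l; case: (unliftP ord0 l) => [j ->|->]; last by rewrite z0 bundle_BLO0.
rewrite bundle_BLO_lift; apply/eqP; rewrite eq_le z_ge1 andbT.
(* As s = |C| + 1, subtracting 1 from every entry turns the constraint into an upper bound 0 on a
   sum of nonnegative excesses, which must all vanish. *)
have excess i : i \in B ->
    (z (lift ord0 i) - 1) + \sum_(j in ~: B) (z (lift ord0 j) - 1) <= 0.
  move/z_le; rewrite sumrB sumr_const /bundle_price -natr1; lra.
have excess_ge0 P : 0 <= \sum_(j | P j) (z (lift ord0 j) - 1).
  by apply: sumr_ge0 => i _; rewrite subr_ge0.
have [jB|jB] := boolP (j \in B).
  by have := excess j jB; have := excess_ge0 [in ~: B]; lra.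
have /set0Pn[i iB] := B0.
have := excess i iB; rewrite (bigD1 j) ?inE //=.
have := excess_ge0 (fun l => (l \in ~: B) && (l != j)); have := z_ge1 i; lra.
Qed.

Lemma bundle_BLO_is_BLO (R : realType) (k : nat) (B : {set 'I_k}) : B != set0 ->
  is_BLO (bundle_auction R k B) (bundle_BLO R k).
Proof.
move=> B0; split=> [|z z_core]; first exact: bundle_BLO_core.
have [eq_z|/leximin_dom_asym//] := bundle_BLO_dom R k B z B0 z_core.
case=> l [_ [_]]; rewrite (_ : sorted_entries z = sorted_entries (bundle_BLO R k)) ?ltxx //.
by rewrite /sorted_entries (eq_map eq_z).
Qed.

(** * Conclusion *)

(** The choice b = [uphalf k], s = k is an equality case of [quarter_square_le]; this dictates the
    size of [B] in the tight auction. *)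
Lemma half_uphalf_square (k : nat) :
  (4 * ((k - uphalf k).+1 * uphalf k) = k * (k + 2) + k %% 2)%N.
Proof.
rewrite uphalf_half modn2; have := odd_double_half k.
move: (k./2) (odd k : nat) (leq_b1 (odd k)) => h o le_o1 <-.
rewrite subnDl -addnn addnK.
have [->|->] : o = 0%N \/ o = 1%N by lia.
  by nia.
by nia.
Qed.

Theorem theorem3 (R : realType) :
  (forall (n : nat) (M : finType) (v : 'I_n -> {set M} -> R)
          (a : 'I_n -> {set M}) (piB piM : 'I_n -> R),
     valuation_ok v -> optimal_alloc v a -> winners a != set0 ->
     is_BLO v piB -> is_MRC v piM ->
     blo_factor R #|winners a| * revenue piM <= revenue piB)
  /\
  (forall k : nat, (0 < k)%N ->
     exists (n : nat) (M : finType) (v : 'I_n -> {set M} -> R)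
            (a : 'I_n -> {set M}),
       valuation_ok v /\ optimal_alloc v a /\ #|winners a| = k /\
       (exists piM, is_MRC v piM /\ 0 < revenue piM) /\
       (exists piB, is_BLO v piB) /\
       (forall piB piM, is_BLO v piB -> is_MRC v piM ->
          revenue piB = blo_factor R k * revenue piM)).
Proof.
split=> [n M v a piB piM v_ok a_opt win0 BLO [coreM _]|k k_gt0].
  apply: (BLO_revenue_ge _ _ _ _ _ _ _ BLO coreM); first by rewrite card_gt0.
  apply: subset_leq_card; apply/subsetP => j; rewrite inE.
  apply: contraTT => /(core_loser0 _ _ _ _ _ _ _ v_ok a_opt (proj1 BLO))->.
  by rewrite ltxx.
have le_bk : (uphalf k <= k)%N by rewrite leq_uphalf_double -addnn leq_addr.
pose B : {set 'I_k} := [set widen_ord le_bk j | j : 'I_(uphalf k)].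
have cardB : #|B| = uphalf k.
  rewrite card_imset ?card_ord // => i j /(congr1 val) /= eq_ij.
  exact: val_inj.
have b_gt0 : (0 < uphalf k)%N by rewrite uphalf_gt0.
have B0 : B != set0 by rewrite -card_gt0 cardB.
exists k.+1, 'I_k, (bundle_auction R k B), (singleton_alloc k).
split; first exact: bundle_auction_ok.
split; first exact: bundle_optimal.
split; first exact: winners_singleton.
split.
  exists (bundle_MRC R k B); split.
    split=> [|y y_core]; first exact: bundle_MRC_core.
    by rewrite bundle_MRC_revenue bundle_core_revenue_le.
  by rewrite bundle_MRC_revenue mulr_gt0 ?bundle_price_gt0 // ltr0n cardB.
split; first by exists (bundle_BLO R k); exact: bundle_BLO_is_BLO.
move=> piB piM [coreB maxB] [coreM maxM].
have [eqB|domB] := bundle_BLO_dom R k B piB B0 coreB; last first.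
  by case: (maxB _ (bundle_BLO_core R k B B0)).
have -> : revenue piB = k%:R.
  by rewrite -(bundle_BLO_revenue R k); apply: eq_bigr => i _; rewrite eqB.
have -> : revenue piM = bundle_price R k B * #|B|%:R.
  apply/eqP; rewrite eq_le bundle_core_revenue_le //=.
  by rewrite -bundle_MRC_revenue; apply/maxM/bundle_MRC_core.
(* What remains is k against (k - b + 1) b times the factor, with b = [uphalf k]. *)
rewrite /bundle_price cardsCs setCK card_ord cardB.
rewrite -[blo_factor R k]invrK blo_factorVE // -half_uphalf_square.
rewrite invf_div -natrM !natrM.
have s0 : (k - uphalf k).+1%:R != 0 :> R by rewrite pnatr_eq0.
have b0 : (uphalf k)%:R != 0 :> R by rewrite pnatr_eq0 -lt0n.
by field; rewrite nat1r s0 b0.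
Qed.
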